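(* Let $k=n-1\ge 2$. Then each subgroup of $S_n$ except $A_n$ is Galois closed over $\mathbf{k}$; that is, a subgroup $G\le S_n$ is Galois closed over $\mathbf{k}$ if and only if $G\neq A_n$.
   Context: For a positive integer $m$ put $\mathbf{m}=\{1,\dots,m\}$. $S_n$ and $A_n$ are the symmetric and alternating groups on $\mathbf{n}$. A permutation $\sigma\in S_n$ (written $i\mapsto i\sigma$) leaves an operation $f\colon\mathbf{k}^n\to\mathbf{k}$ invariant if $f(x_1,\dots,x_n)=f(x_{1\sigma},\dots,x_{n\sigma})$ for all $(x_1,\dots,x_n)\in\mathbf{k}^n$. For $G\le S_n$, the Galois closure $\overline{G}^{(k)}$ of $G$ over $\mathbf{k}$ is the subgroup of $S_n$ consisting of all $\sigma\in S_n$ such that every $f\colon\mathbf{k}^n\to\mathbf{k}$ that is invariant under all elements of $G$ is also invariant under $\sigma$. $G$ is Galois closed over $\mathbf{k}$ if $\overline{G}^{(k)}=G$. *)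

(* Defs.v *)
From mathcomp Require Import all_boot all_fingroup.

Set Implicit Arguments.
Unset Strict Implicit.
Unset Printing Implicit Defensive.

Local Open Scope group_scope.

Notation operation n k := {ffun {ffun 'I_n -> 'I_k} -> 'I_k}.

Definition leaves_invariant (n k : nat) (s : 'S_n) (f : operation n k) : bool :=
  [forall x : {ffun 'I_n -> 'I_k}, f x == f [ffun i => x (s i)]].

Definition galois_closure (n k : nat) (G : {set 'S_n}) : {set 'S_n} :=
  [set s | [forall f : operation n k,
    [forall t in G, leaves_invariant t f] ==> leaves_invariant s f]].

Lemma galois_closureP (n k : nat) (G : {set 'S_n}) (s : 'S_n) :
  reflect
    (forall f : operation n k,
       (forall t, t \in G -> leaves_invariant t f) -> leaves_invariant s f)
    (s \in galois_closure k G).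
Proof.
rewrite inE; apply: (iffP forallP) => H f.
  by move=> HG; apply: (implyP (H f)); apply/forall_inP.
by apply/implyP => /forall_inP; apply: H.
Qed.

Lemma galois_closure_group_set (n k : nat) (G : {set 'S_n}) :
  group_set (galois_closure k G).
Proof.
apply/group_setP; split.
  apply/galois_closureP => f _; apply/forallP => x; apply/eqP; congr (f _).
  by apply/ffunP => i; rewrite ffunE perm1.
move=> s t /galois_closureP Hs /galois_closureP Ht.
apply/galois_closureP => f Hf; apply/forallP => x.
rewrite (eqP (forallP (Ht f Hf) x)) (eqP (forallP (Hs f Hf) _)).
apply/eqP; congr (f _); apply/ffunP => i.
by rewrite !ffunE permM.
Qed.

Canonical galois_closure_group (n k : nat) (G : {set 'S_n}) : {group 'S_n} :=
  Group (galois_closure_group_set k G).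

Definition galois_closed (n k : nat) (G : {set 'S_n}) : bool :=
  galois_closure k G == G.

(* Main.v *)
(** A permutation lies in the Galois closure of [G] iff it moves every colouring
    [x] within its [G]-orbit.  Merging only two points [a], [b] gives a colouring
    with [n - 1] colours, so an [s] in the closure of [G] but outside [G]
    satisfies [s (a b) \in G] for all [a != b].  Hence [G] contains every product
    [(a b) (c d) = (s (a b))^-1 (s (c d))], so [A_n <= G < S_n] and [G = A_n].
    Conversely every colouring with [n - 1] colours repeats a value, at [a] and
    [b] say, and [s] acts on it as the permutation [s (a b)] of opposite sign, so
    the closure of [A_n] is [S_n]. *)
Require Import Defs.
From mathcomp Require Import all_boot all_fingroup alt.

Set Implicit Arguments.
Unset Strict Implicit.
Unset Printing Implicit Defensive.

Local Open Scope group_scope.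

(** The indicator function of the [G]-orbit of [x] is [G]-invariant, hence [s]-invariant. Its two
    values require [1 < k]. *)
Lemma galois_closure_orbit (n k : nat) (G : {group 'S_n}) (s : 'S_n)
    (x : {ffun 'I_n -> 'I_k}) :
  (1 < k)%N -> s \in galois_closure k G ->
  exists2 t, t \in G & forall i, x (s i) = x (t i).
Proof.
move=> k_gt1 /galois_closureP sP.
pose inO y := [exists t in G, y == [ffun i => x (t i)]].
pose f : operation n k :=
  [ffun y => if inO y then Ordinal k_gt1 else Ordinal (ltnW k_gt1)].
have inO_act y t : t \in G -> inO y -> inO [ffun i => y (t i)].
  move=> Gt /exists_inP[u Gu /eqP->]; apply/exists_inP.
  exists (t * u); first by rewrite groupM.
  by apply/eqP/ffunP=> i; rewrite !ffunE permM.
have f_inv t : t \in G -> leaves_invariant t f.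
  move=> Gt; apply/forallP=> y; rewrite !ffunE.
  suff -> : inO [ffun i => y (t i)] = inO y by [].
  apply/idP/idP; last exact: inO_act.
  move/(inO_act _ t^-1); rewrite groupV => /(_ Gt).
  by congr (inO _); apply/ffunP=> i; rewrite !ffunE permKV.
have inOx : inO x.
  apply/exists_inP; exists 1 => //.
  by apply/eqP/ffunP=> i; rewrite ffunE perm1.
have /forallP/(_ x) := sP f f_inv; rewrite !ffunE inOx.
case: ifP => // /exists_inP[t Gt /eqP xE] _; exists t => // i.
by have /ffunP/(_ i) := xE; rewrite !ffunE.
Qed.

Lemma orbit_galois_closure (n k : nat) (G : {set 'S_n}) (s : 'S_n) :
  (forall x : {ffun 'I_n -> 'I_k},
     exists2 t, t \in G & forall i, x (s i) = x (t i)) ->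
  s \in galois_closure k G.
Proof.
move=> sG; apply/galois_closureP=> f fG; apply/forallP=> x.
have [t Gt xE] := sG x; rewrite (eqP (forallP (fG t Gt) x)); apply/eqP.
by congr (f _); apply/ffunP=> i; rewrite !ffunE.
Qed.

Lemma merge_colouring (m : nat) (a b : 'I_m.+1) : a != b ->
  exists x : {ffun 'I_m.+1 -> 'I_m},
    forall i j, x i = x j -> i = j \/ i = tperm a b j.
Proof.
rewrite eq_sym => /unlift_some[c a_c _].
(* [unlift b] numbers the points other than [b]; the default [c], given to [b], is the number of
   [a]. *)
exists [ffun i => odflt c (unlift b i)] => i j; rewrite !ffunE.
case: unliftP => [i'|] ->; case: unliftP => [j'|] -> /= E.
- by left; rewrite E.
- by right; rewrite tpermR E.
- by right; rewrite -E -a_c tpermL.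
- by left.
Qed.

(** Every point other than [a] and [b] is fixed, and by injectivity the choice made at [a] forces
    the one at [b]. *)
Lemma perm_id_or_tperm (T : finType) (a b : T) (p : {perm T}) :
  (forall i, p i = i \/ p i = tperm a b i) -> p = 1 \/ p = tperm a b.
Proof.
move=> pP; have pab i : i != a -> i != b -> p i = i.
  by move=> ia ib; case: (pP i) => // ->; rewrite tpermD // eq_sym.
case: (pP a) => pa; [left | right]; apply/permP=> i; rewrite ?perm1.
- have [-> // | ia] := eqVneq i a; have [ib | ib] := eqVneq i b; last exact: pab.
  case: (pP i) => // pi; move: pi; rewrite {2}ib tpermR -[RHS]pa => /perm_inj ia'.
  by rewrite ia' eqxx in ia.
- have [-> // | ia] := eqVneq i a; have [ib | ib] := eqVneq i b; last first.
    by rewrite pab // tpermD // eq_sym.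
  case: (pP i) => // pi; move: pi pa; rewrite tpermL {2}ib => <- /perm_inj ai.
  by rewrite ai eqxx in ia.
Qed.

Lemma galois_closure_mul_tperm (m : nat) (G : {group 'S_m.+1}) (s : 'S_m.+1) :
  (1 < m)%N -> s \in galois_closure m G -> s \notin G ->
  forall a b, a != b -> s * tperm a b \in G.
Proof.
move=> m_gt1 sG nGs a b neq_ab; have [x xP] := merge_colouring neq_ab.
have [t Gt st] := galois_closure_orbit x m_gt1 sG.
(* [t^-1 * s] preserves the colouring [x], whose only nontrivial class is that of [a] and [b]; being
   trivial would put [s] in [G]. *)
have [] := @perm_id_or_tperm _ a b (t^-1 * s).
- by move=> i; apply: xP; rewrite permM st permKV.
- by move/(canRL (mulKVg t)); rewrite mulg1 => sE; rewrite sE Gt in nGs.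
- by move/(canRL (mulKVg t)) => ->; rewrite -mulgA tperm2 mulg1.
Qed.

Lemma Alt_of_mul_tperm (T : finType) (G : {group {perm T}}) (s : {perm T}) :
  s \notin G -> (forall a b, a != b -> s * tperm a b \in G) ->
  G :=: 'Alt_T.
Proof.
move=> nGs Gs.
(* Induction on a factorization into transpositions: [s] is present exactly when [u] is odd, and an
   odd tail is cleared of it by multiplying with [(s * tperm a b)^-1]. *)
have Gsign u : s ^+ odd_perm u * u \in G.
  have [ts -> dts] := prod_tpermP u.
  elim: ts dts => [_ | [a b] ts IH /= /andP[ab /IH{IH}]].
    by rewrite big_nil odd_perm1 mulg1 group1.
  rewrite big_cons odd_permM odd_tperm ab /=.
  case: (odd_perm _) => /= Gu; last first.
    by rewrite expg1 mulgA groupM ?Gs //; rewrite mul1g in Gu.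
  have := groupM (groupVr (Gs a b ab)) Gu.
  by rewrite invMg tpermV mul1g -mulgA expg1 mulKg.
apply/setP=> u; rewrite Alt_even; have := Gsign u.
case: (odd_perm u) => /=; last by rewrite mul1g => ->.
(* An odd [u] in [G] would give [s \in G], since [s * u \in G]. *)
rewrite expg1 => Gsu; apply/negP=> Gu.
by rewrite (groupMr _ Gu) (negPf nGs) in Gsu.
Qed.

Lemma galois_closure_Alt (n k : nat) :
  (k < n)%N -> galois_closure k 'Alt_('I_n) = [set: 'S_n].
Proof.
move=> lt_kn; apply/setP=> s; rewrite in_setT.
apply: orbit_galois_closure => x.
have [s_odd | s_even] := boolP (odd_perm s); last first.
  by exists s; rewrite // Alt_even.
have [a [b ab xab]] : exists a : 'I_n, exists2 b, a != b & x a = x b.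
  have /injectivePn[a [b ab xab]] : ~~ injectiveb x.
    apply: contraL lt_kn => /injectiveP/leq_card.
    by rewrite !card_ord -leqNgt.
  by exists a, b.
exists (s * tperm a b); first by rewrite Alt_even odd_permM odd_tperm ab s_odd.
by move=> i; rewrite permM; case: tpermP => [->|->|].
Qed.

Theorem proposition3p4 (n k : nat) (hk : k = (n - 1)%N) (hk2 : (2 <= k)%N)
    (G : {group 'S_n}) :
  galois_closed k G <-> G <> ('Alt_('I_n))%g :> {set 'S_n}.
Proof.
case: n hk G => [|m] hk G; first by rewrite hk in hk2.
rewrite subn1 /= in hk; subst k; split=> [/eqP clG GA | nGA].
  (* An odd permutation separates the full group from the alternating one; [inord 1] is a genuine
     second point because [1 < m.+1]. *)
  have : tperm ord0 (inord 1) \in [set: 'S_m.+1] by rewrite in_setT.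
  rewrite -(galois_closure_Alt (ltnSn m)) -GA clG GA Alt_even odd_tperm.
  by rewrite -val_eqE /= inordK // ltnW.
rewrite /galois_closed eqEsubset; apply/andP; split; apply/subsetP=> s sG.
  apply: contra_notT nGA => nGs; apply: (Alt_of_mul_tperm nGs).
  exact: galois_closure_mul_tperm.
by apply: orbit_galois_closure => x; exists s.
Qed.
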